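(* Let $F_\infty$ be the free group on countably many generators $(g_i)_{i\in\mathbb{N}}$ and let $\lambda$ be its left regular representation on $\ell^2(F_\infty)$. Let $d\geq 1$ be an integer, and for $k=(k_1,\dots,k_d)\in\mathbb{N}^d$ let $g_k=g_{k_1}g_{k_2}\cdots g_{k_d}\in F_\infty$. Let $a=(a_k)_{k\in\mathbb{N}^d}$ be a finitely supported family of complex $n\times n$ matrices, and for $0\leq l\leq d$ let $M_l=\left(a_{(k_1,\dots,k_l),(k_{l+1},\dots,k_d)}\right)$ be the corresponding $\mathbb{N}^l\times\mathbb{N}^{d-l}$ block-matrix. Then $$\left\|\sum_{k\in\mathbb{N}^d}a_k\otimes\lambda(g_k)\right\|\leq 4^5\sqrt{e}\left(\sum_{l=0}^d\|M_l\|^2\right)^{1/2}.$$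
   Context: The norm on the left is the operator norm on $\mathbb{C}^n\otimes\ell^2(F_\infty)$ (i.e. the norm of $M_n(\mathbb{C})\otimes C^*_\lambda(F_\infty)$). The block-matrix $M_l$ is the (finite rank) operator from $\mathbb{C}^n\otimes\ell^2(\mathbb{N})^{\otimes (d-l)}$ to $\mathbb{C}^n\otimes\ell^2(\mathbb{N})^{\otimes l}$ whose block with row index $s=(k_1,\dots,k_l)\in\mathbb{N}^l$ and column index $t=(k_{l+1},\dots,k_d)\in\mathbb{N}^{d-l}$ is $a_{(k_1,\dots,k_d)}$; $\|M_l\|$ is its operator norm. ($\mathbb{N}^0$ is a one-point set and $\ell^2(\mathbb{N})^{\otimes 0}=\mathbb{C}$.) *)

(* Defs.v *)
From HB Require Import structures.
From mathcomp Require Import all_boot all_order all_algebra.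
From mathcomp Require Import complex.
From mathcomp Require Import all_classical all_reals all_analysis.

Set Implicit Arguments.
Unset Strict Implicit.
Unset Printing Implicit Defensive.

Import Order.TTheory GRing.Theory Num.Theory.

Local Open Scope classical_set_scope.
Local Open Scope ring_scope.

(* The letter (t, b) stands for the generator t if b is false, and for its
   inverse if b is true. *)
Section ReducedWords.
Variable T : choiceType.

Definition inv_letter (x : T * bool) : T * bool := (x.1, ~~ x.2).

Definition reduced (w : seq (T * bool)) : bool :=
  sorted (fun x y => y != inv_letter x) w.

Definition cons_letter (x : T * bool) (w : seq (T * bool)) :=
  if w is y :: w' then (if y == inv_letter x then w' else x :: w) else [:: x].

Definition rmul (u v : seq (T * bool)) := foldr cons_letter v u.

Definition rinv (u : seq (T * bool)) := rev (map inv_letter u).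

Record free_group := FreeGroup {
  fg_word :> seq (T * bool);
  fg_reduced : reduced fg_word
}.

HB.instance Definition _ := [isSub for fg_word].
HB.instance Definition _ := [Choice of free_group by <:].

Lemma inv_letterK : involutive inv_letter.
Proof. by case=> t b; rewrite /inv_letter /= negbK. Qed.

Lemma inv_letter_eq x y : (x == inv_letter y) = (y == inv_letter x).
Proof. by apply/eqP/eqP => ->; rewrite inv_letterK. Qed.

Lemma reduced_behead x w : reduced (x :: w) -> reduced w.
Proof. by case: w => //= y w /andP[]. Qed.

Lemma cons_letter_reduced x w : reduced w -> reduced (cons_letter x w).
Proof.
case: w => //= y w rw; case: ifP => [_|/negbT yx]; last by rewrite /= yx.
exact: (reduced_behead rw).
Qed.

Lemma rmul_reduced u v : reduced v -> reduced (rmul u v).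
Proof. by move=> rv; elim: u => //= x u; apply: cons_letter_reduced. Qed.

Lemma cons_letterK x w :
  reduced w -> cons_letter (inv_letter x) (cons_letter x w) = w.
Proof.
case: w => [|y w] /=; first by rewrite inv_letterK eqxx.
case: ifP => [/eqP -> | _ _]; last by rewrite /= inv_letterK eqxx.
case: w => [|z w] //= /andP[zy _]; by rewrite (negbTE zy).
Qed.

Lemma rmul_cons_letter x u w : reduced w ->
  rmul (cons_letter x u) w = cons_letter x (rmul u w).
Proof.
move=> rw; case: u => //= y u; case: ifP => //= /eqP ->.
by rewrite -[X in cons_letter X]inv_letterK cons_letterK// rmul_reduced.
Qed.

Lemma rmulA u v w : reduced w -> rmul u (rmul v w) = rmul (rmul u v) w.
Proof. by move=> rw; elim: u => //= x u ->; rewrite rmul_cons_letter. Qed.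

Lemma rmul_nil u : reduced u -> rmul u [::] = u.
Proof.
elim: u => //= x [|y u] IH //= /andP[yx ru].
by move: IH => /= -> //; rewrite /= (negbTE yx).
Qed.

Lemma rinv_reduced u : reduced u -> reduced (rinv u).
Proof.
rewrite /reduced /rinv rev_sorted sorted_map.
by apply: sub_sorted => x y /=; rewrite inv_letterK eq_sym.
Qed.

Lemma rinvK : involutive rinv.
Proof.
by move=> u; rewrite /rinv map_rev revK -map_comp map_id_in// => x _ /=;
   rewrite inv_letterK.
Qed.

Lemma rmul_cat u v w : rmul (u ++ v) w = rmul u (rmul v w).
Proof. exact: foldr_cat. Qed.

Lemma rmulV u v : reduced v -> rmul (rinv u) (rmul u v) = v.
Proof.
move=> rv; elim: u => //= x u IH.
rewrite /rinv /= rev_cons -cats1 rmul_cat /=.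
by rewrite cons_letterK ?rmul_reduced.
Qed.

Definition fg_mul (u v : free_group) : free_group :=
  FreeGroup (rmul_reduced u (fg_reduced v)).
Definition fg_one : free_group := @FreeGroup [::] isT.
Definition fg_inv (u : free_group) : free_group :=
  FreeGroup (rinv_reduced (fg_reduced u)).

Fact fg_mulA : associative fg_mul.
Proof. by move=> u v w; apply: val_inj; rewrite /= rmulA// fg_reduced. Qed.

Fact fg_mul1 : left_id fg_one fg_mul.
Proof. by move=> u; apply: val_inj. Qed.

Fact fg_mulr1 : right_id fg_one fg_mul.
Proof. by move=> u; apply: val_inj; rewrite /= rmul_nil// fg_reduced. Qed.

Fact fg_mulV : left_inverse fg_one fg_inv fg_mul.
Proof.
move=> u; apply: val_inj => /=.
by rewrite -[X in rmul _ X]rmul_nil ?fg_reduced// rmulV.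
Qed.

Fact fg_invK : involutive fg_inv.
Proof. by move=> u; apply: val_inj; rewrite /= rinvK. Qed.

Fact fg_invM : {morph fg_inv : x y / fg_mul x y >-> fg_mul y x}.
Proof.
move=> x y; set p := fg_mul x y; set q := fg_mul _ _.
have qp : fg_mul q p = fg_one.
  by rewrite /q /p -fg_mulA (fg_mulA _ x) fg_mulV fg_mul1 fg_mulV.
have pV : fg_mul p (fg_inv p) = fg_one.
  by rewrite -{1}[p]fg_invK fg_mulV.
by rewrite -[fg_inv p]fg_mul1 -qp -fg_mulA pV fg_mulr1.
Qed.

HB.instance Definition _ := isStarMonoid.Build free_group
  fg_mulA fg_mul1 fg_invK fg_invM.
HB.instance Definition _ := StarMonoid_isGroup.Build free_group fg_mulV.

Definition fg_gen (t : T) : free_group := @FreeGroup [:: (t, false)] isT.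

End ReducedWords.

Section Operators.
Variable R : realType.
Local Notation C := R[i].

(* The Hilbert space C^n (x) l^2(I) is l^2(I; C^n): the functions v : I -> C^n
   with l2norm v < +oo. *)
Definition l2norm n (I : choiceType) (v : I -> 'cV[C]_n) : \bar R :=
  sqrte (\esum_(x in [set: I])
    (\sum_(i < n) (ComplexField.Normc.normc (v x i ord0)) ^+ 2)%:E).

(* Norm of a linear operator C^n (x) l^2(I) -> C^n (x) l^2(J); it is +oo when the
   operator is unbounded or does not map into C^n (x) l^2(J). *)
Definition opnorm n (I J : choiceType)
    (A : (I -> 'cV[C]_n) -> (J -> 'cV[C]_n)) : \bar R :=
  ereal_sup [set l2norm (A v) | v in [set v | (l2norm v <= 1)%E]].

Definition left_regular (G : groupType) (g : G) (f : G -> C) : G -> C :=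
  fun x => f (g^-1 * x)%g.

(* B (x) A; the i-th component of v : I -> C^n is fun x => v x i ord0. *)
Definition tensor_op n (I J : choiceType)
    (B : 'M[C]_n) (A : (I -> C) -> (J -> C)) (v : I -> 'cV[C]_n) :
    J -> 'cV[C]_n :=
  fun y => B *m \col_(i < n) A (fun x => v x i ord0) y.

(* When the support of t |-> M s t *m v t is infinite the sum is 0 by
   convention; for finitely supported M it is always the actual sum. *)
Definition block_op n (I J : choiceType) (M : J -> I -> 'M[C]_n)
    (v : I -> 'cV[C]_n) : J -> 'cV[C]_n :=
  fun s => \sum_(t \in [set: I]) M s t *m v t.

Definition cat_index d (l : 'I_d.+1) (s : l.-tuple nat)
    (t : (d - l).-tuple nat) : d.-tuple nat :=
  tcast (subnKC (leq_ord l)) [tuple of s ++ t].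

Definition block_matrix d n (a : d.-tuple nat -> 'M[C]_n) (l : 'I_d.+1)
    (s : l.-tuple nat) (t : (d - l).-tuple nat) : 'M[C]_n :=
  a (cat_index s t).

End Operators.

Arguments block_matrix [R d n] a l s t.

Definition gen_word d (k : d.-tuple nat) : free_group nat :=
  (\prod_(i < d) fg_gen (tnth k i))%g.

(* Main.v *)
Require Import Defs.
From HB Require Import structures.
From mathcomp Require Import all_boot all_order all_algebra.
From mathcomp Require Import complex finmap.
From mathcomp Require Import all_classical all_reals all_analysis.
From mathcomp Require Import ring lra.

Set Implicit Arguments.
Unset Strict Implicit.
Unset Printing Implicit Defensive.

Import Order.TTheory GRing.Theory Num.Theory.

Local Open Scope classical_set_scope.
Local Open Scope ring_scope.

(** The inequality holds with the constant 2 instead of [4^5 sqrt e].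

   Let [A] be the operator on the left and [v] a vector. For a reduced word [y]
   and a positive word [k = k_1 ... k_d], let [l] be the length of the longest
   common prefix of [k] and [y]. Then [g_k^-1 y] is the reduced word
   [k_d^-1 ... k_(l+1)^-1 w], where [y = k_1 ... k_l w]. Grouping the terms of
   [(A v)(y) = sum_k a_k v(g_k^-1 y)] according to [l] gives
   [A v = sum_l T_l V], where [V] extends [v] by 0 to the nonreduced words and
   [(T_l V)(s w) = sum_t a_(s,t) V(t^-1 w)] for [s] of length [l], [t] of length
   [d - l] (lemma [sum_tensor_opE]; [T_l] is [prefix_op l]). For each tail [w]
   this is the block matrix [M_l], so the norm of [T_l] is at most that of
   [M_l] (lemma [l2sq_prefix_op]).

   A gain over the triangle inequality comes from orthogonality. Call a term
   [(T_l V)(y)] main if [l] is the length of the initial positive run of [y].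
   For each [y] at most one term is main, so the main terms have orthogonal
   ranges and their sum has square norm at most
   [sum_l |M_l|^2 |v|^2]. In the other nonzero terms [w] begins with a
   positive letter, so [T_l V] only depends on the restriction [V_l] of [V] to
   words with exactly [d - l] initial inverse letters
   (lemma [prefix_op_restrict]). The [V_l] are orthogonal for distinct [l], and
   by Cauchy-Schwarz the sum of these terms also has square norm at most
   [(sum_l |M_l|^2) (sum_l |V_l|^2)], hence at most [sum_l |M_l|^2 |v|^2].
   Finally, [|x + y|^2 <= 2 |x|^2 + 2 |y|^2]. *)

(** * Words *)

(** The word [g_(s_1) g_(s_2) ...] in the generators. *)
Definition pos_word (s : seq nat) : seq (nat * bool) :=
  [seq (i, false) | i <- s].

(** The inverse of [pos_word s]. *)
Definition neg_word (s : seq nat) : seq (nat * bool) := rinv (pos_word s).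

Lemma pos_word_inj : injective pos_word.
Proof. by apply: inj_map => i j []. Qed.

Lemma size_neg_word s : size (neg_word s) = size s.
Proof. by rewrite size_rev !size_map. Qed.

Lemma neg_word_inj : injective neg_word.
Proof. move=> s t h; apply: pos_word_inj; exact: (inv_inj (@rinvK _) h). Qed.

Lemma neg_word_cons i s w :
  neg_word (i :: s) ++ w = neg_word s ++ (i, true) :: w.
Proof. by rewrite /neg_word /rinv /= rev_cons cat_rcons. Qed.

Lemma reduced_neg_word_cat s i w :
  reduced (neg_word s ++ (i, true) :: w) = reduced ((i, true) :: w).
Proof.
elim: s i w => [|j s IH] i w; first by [].
by rewrite neg_word_cons IH /= xpair_eqE andbF.
Qed.

Lemma rmul_reduced_cat (T : choiceType) (u v : seq (T * bool)) :
  reduced (u ++ v) -> rmul u v = u ++ v.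
Proof.
move=> ruv; rewrite -[RHS]rmul_nil// rmul_cat rmul_nil//.
elim: u ruv => //= x u IH xuv; exact/IH/(reduced_behead xuv).
Qed.

Lemma find_pos_word_cat s w :
  find snd (pos_word s ++ w) = (size s + find snd w)%N.
Proof. by elim: s => //= i s ->. Qed.

Lemma find_neg_word_cat s w :
  find (predC snd) (neg_word s ++ w) = (size s + find (predC snd) w)%N.
Proof.
elim: s w => //= i s IH w; by rewrite neg_word_cons IH /= addnS addSn.
Qed.

Lemma gen_wordE d (k : d.-tuple nat) : fg_word (gen_word k) = pos_word k.
Proof.
case: k => k hk; rewrite /gen_word /=; elim: k d hk => [|i k IH] [|d] // hk.
  by rewrite big_ord0.
rewrite big_ord_recl /=.
have hk' : size k == d by [].
rewrite (eq_bigr (fun j => fg_gen (tnth (Tuple hk') j))); last first.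
  by move=> j _; rewrite !(tnth_nth 0%N).
rewrite IH (tnth_nth 0%N) /=; case: (k) => //= j k'.
by rewrite xpair_eqE andbF.
Qed.

(** The extension of a function on the free group by 0 to all words. *)
Definition extend0 (T : choiceType) (V : zmodType) (v : free_group T -> V)
  (w : seq (T * bool)) : V := if insub w is Some x then v x else 0.

Lemma extend0E (T : choiceType) (V : zmodType) (v : free_group T -> V)
  (x : free_group T) : extend0 v (fg_word x) = v x.
Proof. by rewrite /extend0 valK. Qed.

Lemma extend0_out (T : choiceType) (V : zmodType) (v : free_group T -> V) w :
  ~~ reduced w -> extend0 v w = 0.
Proof. by move=> h; rewrite /extend0 insubN. Qed.

(** Left multiplication by the inverse of [k_1 ... k_d]. The only nonzero term
   on the right is the one where [l] is the length of the longest common prefix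
   of [k] and [y]: for smaller [l] the word is not reduced, and for larger [l]
   the test fails. *)
Lemma extend0_rmul_neg (V : zmodType) (v : free_group nat -> V) k y :
  reduced y ->
  extend0 v (rmul (neg_word k) y) =
  \sum_(l < (size k).+1)
    if pos_word (take l k) == take l y
    then extend0 v (neg_word (drop l k) ++ drop l y) else 0.
Proof.
elim: k y => [|i k IH] y ry.
  by rewrite big_ord_recl big_ord0 addr0 /= take0 drop0.
have -> : rmul (neg_word (i :: k)) y =
          rmul (neg_word k) (cons_letter (i, true) y).
  by rewrite -[neg_word _]cats0 neg_word_cons rmul_cat.
rewrite big_ord_recl /= take0 /= drop0.
case: y ry => [_|z y ry] /=.
  rewrite cats0 big1 ?addr0// rmul_reduced_cat ?reduced_neg_word_cat//.
  by rewrite -[neg_word (i :: k)]cats0 neg_word_cons.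
rewrite /inv_letter /=; case: eqVneq ry => [->|zi] ry.
  rewrite IH ?(reduced_behead ry)// neg_word_cons extend0_out ?add0r;
    last first.
    by rewrite reduced_neg_word_cat /= eqxx.
  by apply: eq_bigr => l _; rewrite add0n /= eqseq_cons eqxx.
rewrite neg_word_cons rmul_reduced_cat ?big1 ?addr0//.
  by move=> l _; rewrite add0n /= eqseq_cons eq_sym (negbTE zi).
by rewrite reduced_neg_word_cat /= zi.
Qed.

(** * Square norms *)

Section SquareNorm.
Variable R : realType.
Local Notation C := R[i].
Local Notation normc := (@ComplexField.Normc.normc R).

Lemma normc_ge0 (x : C) : 0 <= normc x.
Proof. by case: x => a b; exact: sqrtr_ge0. Qed.

Lemma normcD_le (x y : C) : normc (x + y) <= normc x + normc y.
Proof. exact: le_normcD. Qed.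

Lemma normc_real (r : R) : normc r%:C%C = `|r|.
Proof. by rewrite /ComplexField.Normc.normc /= expr0n addr0 sqrtr_sqr. Qed.

Lemma normc_sum_le m (x : 'I_m -> C) :
  normc (\sum_i x i) <= \sum_i normc (x i).
Proof.
elim/big_rec2: _ => [|i r z _ h]; first by rewrite ComplexField.Normc.normc0.
by apply: le_trans (normcD_le _ _) _; rewrite lerD2l.
Qed.

(** Cauchy-Schwarz with weights [c]; division by 0 gives 0, hence the
   hypothesis on the indices where [c] vanishes. *)
Lemma sum_sqr_le m (r c : 'I_m -> R) :
  (forall i, 0 <= c i) -> (forall i, c i = 0 -> r i = 0) ->
  (\sum_i r i) ^+ 2 <= (\sum_i c i) * \sum_i r i ^+ 2 / c i.
Proof.
move=> c0 cr.
have: [/\ 0 <= \sum_i c i, 0 <= \sum_i r i ^+ 2 / c i &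
  (\sum_i r i) ^+ 2 <= (\sum_i c i) * \sum_i r i ^+ 2 / c i].
  elim/big_rec3: _ => [|i s Y X _ [X0 Y0 h]]; first by rewrite expr0n mulr0.
  have D0 : 0 <= r i ^+ 2 / c i by rewrite divr_ge0// sqr_ge0.
  have e : r i ^+ 2 = c i * (r i ^+ 2 / c i).
    have [c0i|c0i] := eqVneq (c i) 0; first by rewrite c0i (cr _ c0i); ring.
    by field.
  split; rewrite ?addr_ge0//.
  move: (r i ^+ 2 / c i) D0 e => D D0 e; move: (c i) (c0 i) e => ci ci0 e.
  set t := r i in e *.
  have P0 : 0 <= ci * Y by rewrite mulr_ge0.
  have Q0 : 0 <= X * D by rewrite mulr_ge0.
  have h2 : (t * s) ^+ 2 <= (ci * Y) * (X * D).
    rewrite exprMn e [leRHS](_ : _ = ci * D * (X * Y)); last by ring.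
    exact/ler_wpM2l/h/mulr_ge0.
  (* the geometric mean is at most the arithmetic mean *)
  have h3 : 2 * (t * s) <= ci * Y + X * D.
    move: (t * s) (ci * Y) (X * D) P0 Q0 h2 => z P Q P0 Q0 h2.
    rewrite leNgt; apply/negP => hlt.
    have : (P + Q) ^+ 2 < (2 * z) ^+ 2.
      rewrite ltr_sqr ?nnegrE ?addr_ge0//.
      by rewrite ltW// (le_lt_trans _ hlt) ?addr_ge0.
    by have := sqr_ge0 (P - Q); lra.
  by rewrite sqrrD e mulrDl !mulrDr -mulr_natl; lra.
by case.
Qed.

Variable n : nat.

(** The square of the Hermitian norm on [C^n]. *)
Definition sqn (x : 'cV[C]_n) : R := \sum_(i < n) normc (x i ord0) ^+ 2.

Lemma sqn_ge0 x : 0 <= sqn x.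
Proof. by apply: sumr_ge0 => i _; exact: sqr_ge0. Qed.

Lemma sqn0 : sqn 0 = 0.
Proof.
by apply: big1 => i _; rewrite mxE ComplexField.Normc.normc0 expr0n.
Qed.

Lemma sqn_entry_eq0 x i : sqn x = 0 -> normc (x i ord0) = 0.
Proof.
move=> /eqP; rewrite psumr_eq0; last by move=> j _; exact: sqr_ge0.
by move=> /allP /(_ i (mem_index_enum _)) /=; rewrite sqrf_eq0 => /eqP.
Qed.

Lemma sqn_eq0 x : sqn x = 0 -> x = 0.
Proof.
move=> x0; apply/colP => i; rewrite mxE.
exact/ComplexField.Normc.eq0_normc/sqn_entry_eq0.
Qed.

Lemma sqnZ (r : R) x : sqn (r%:C%C *: x) = r ^+ 2 * sqn x.
Proof.
rewrite /sqn mulr_sumr; apply: eq_bigr => i _.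
by rewrite mxE ComplexField.Normc.normcM exprMn normc_real real_normK ?num_real.
Qed.

Lemma sqnD_le x y : sqn (x + y) <= 2 * sqn x + 2 * sqn y.
Proof.
rewrite /sqn !mulr_sumr -big_split /=; apply: ler_sum => i _; rewrite mxE.
have h := normcD_le (x i ord0) (y i ord0).
have := normc_ge0 (x i ord0 + y i ord0).
move: h (normc_ge0 (x i ord0)) (normc_ge0 (y i ord0)).
move: (normc (x i _)) (normc (y i _)) (normc _) => b c a h b0 c0 a0.
have h2 : a ^+ 2 <= (b + c) ^+ 2 by rewrite ler_sqr ?nnegrE ?addr_ge0.
by apply: le_trans h2 _; have := sqr_ge0 (b - c); lra.
Qed.

Lemma sqn_sum_le m (x : 'I_m -> 'cV[C]_n) (c : 'I_m -> R) :
  (forall l, 0 <= c l) -> (forall l, c l = 0 -> x l = 0) ->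
  sqn (\sum_l x l) <= (\sum_l c l) * \sum_l sqn (x l) / c l.
Proof.
move=> c0 cx; rewrite /sqn.
under [X in _ <= _ * X]eq_bigr => l _ do rewrite mulr_suml.
rewrite exchange_big mulr_sumr /=; apply: ler_sum => i _.
rewrite summxE; apply: le_trans (sum_sqr_le _ _) => //.
  rewrite ler_sqr ?nnegrE ?normc_ge0 ?sumr_ge0//; first exact: normc_sum_le.
  by move=> l _; exact: normc_ge0.
by move=> l /cx ->; rewrite mxE ComplexField.Normc.normc0.
Qed.

(** The square of [l2norm], as a possibly infinite sum. *)
Definition l2sq (I : choiceType) (v : I -> 'cV[C]_n) : \bar R :=
  (\esum_(x in [set: I]) (sqn (v x))%:E)%E.

Lemma l2normE (I : choiceType) (v : I -> 'cV[C]_n) : l2norm v = sqrte (l2sq v).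
Proof. by []. Qed.

Lemma l2sq_ge0 (I : choiceType) (v : I -> 'cV[C]_n) : (0 <= l2sq v)%E.
Proof. by apply: esum_ge0 => x _; rewrite lee_fin sqn_ge0. Qed.

Lemma sqn_le_l2sq (I : choiceType) (v : I -> 'cV[C]_n) x :
  ((sqn (v x))%:E <= l2sq v)%E.
Proof.
rewrite /l2sq (esumID [set x]); last by move=> y _; rewrite lee_fin sqn_ge0.
rewrite setTI esum_set1 ?lee_fin ?sqn_ge0// leeDl// esum_ge0// => y _.
by rewrite lee_fin sqn_ge0.
Qed.

End SquareNorm.
Arguments l2normE {R n I}.

Lemma esumZl_le (R : realType) (T : choiceType) (D : set T) (c : R)
  (f : T -> \bar R) : 0 <= c -> (forall x, D x -> (0 <= f x)%E) ->
  (\esum_(x in D) (c%:E * f x) <= c%:E * \esum_(x in D) f x)%E.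
Proof.
move=> c0 f0; apply: ge_ereal_sup => _ [F [finF FD]] <-.
rewrite fsbig_finite//= big_seq -ge0_sume_distrr -?big_seq; last first.
  by move=> x; rewrite in_fset_set// inE => /FD /f0.
rewrite lee_wpmul2l ?lee_fin// -fsbig_finite//; apply: ereal_sup_ubound.
by exists F.
Qed.

Lemma esumZl (R : realType) (T : choiceType) (D : set T) (c : R)
  (f : T -> \bar R) : 0 <= c -> (forall x, D x -> (0 <= f x)%E) ->
  (\esum_(x in D) (c%:E * f x) = c%:E * \esum_(x in D) f x)%E.
Proof.
move=> c0 f0; have [->|cn0] := eqVneq c 0.
  by rewrite mul0e esum1// => x _; rewrite mul0e.
apply/eqP; rewrite eq_le esumZl_le//=.
have cV : (forall x : \bar R, c%:E * (c^-1%:E * x) = x)%E.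
  by move=> x; rewrite muleA -EFinM divff// mul1e.
have cV' : (forall x : \bar R, c^-1%:E * (c%:E * x) = x)%E.
  by move=> x; rewrite muleA -EFinM mulVf// mul1e.
rewrite -[leRHS]cV lee_wpmul2l ?lee_fin//.
rewrite -[X in (X <= _)%E](eq_esum (fun x _ => cV' (f x))).
apply: esumZl_le; first by rewrite invr_ge0.
by move=> x Dx; rewrite mule_ge0 ?f0.
Qed.

Lemma esum_inj_le (R : realType) (T T' : choiceType) (e : T -> T')
  (f : T' -> \bar R) : injective e -> (forall x, (0 <= f x)%E) ->
  (\esum_(x in [set: T]) f (e x) <= \esum_(y in [set: T']) f y)%E.
Proof.
move=> ie f0; rewrite -esum_image; last exact: (in2W ie).
by rewrite esum_mkcond; apply: le_esum => y _; case: ifP.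
Qed.

Lemma esum_inj_eq (R : realType) (T T' : choiceType) (e : T -> T')
  (f : T' -> \bar R) : injective e -> (forall y, f y != 0%E -> range e y) ->
  (\esum_(y in [set: T']) f y = \esum_(x in [set: T]) f (e x))%E.
Proof.
move=> ie f0; rewrite -[RHS]esum_image; last exact: (in2W ie).
rewrite [RHS]esum_mkcond; apply: eq_esum => y _; case: ifPn => // /negP ny.
by apply/eqP; apply: contraPT ny => /f0 h []; rewrite inE.
Qed.

Lemma esum_pair (R : realType) (T T' : choiceType) (f : T -> T' -> \bar R) :
  (forall x y, (0 <= f x y)%E) ->
  (\esum_(x in [set: T]) \esum_(y in [set: T']) f x y =
   \esum_(z in [set: T * T']) f z.1 z.2)%E.
Proof.
by move=> f0; rewrite esum_esum//; congr esum; apply/seteqP; split.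
Qed.

(** * Operator norms *)

Lemma opnorm_ge0 (R : realType) n (I J : choiceType)
  (A : (I -> 'cV[R[i]]_n) -> (J -> 'cV[R[i]]_n)) : (0 <= opnorm A)%E.
Proof.
apply: (@le_trans _ _ (l2norm (A (fun=> 0)))); first exact: sqrte_ge0.
apply: ereal_sup_ubound; exists (fun=> 0) => //=.
by rewrite l2normE /l2sq esum1 ?sqrte0// => x _; rewrite sqn0.
Qed.

(** [opnorm] is a supremum over the unit ball; homogeneity under real scalars
   is all that is needed to bound [A u] for arbitrary [u]. *)
Lemma l2sq_le_opnorm (R : realType) n (I J : choiceType)
  (A : (I -> 'cV[R[i]]_n) -> (J -> 'cV[R[i]]_n)) (u : I -> 'cV[R[i]]_n) :
  (forall (r : R) v, A (fun x => r%:C%C *: v x) = (fun y => r%:C%C *: A v y)) ->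
  (l2sq u < +oo)%E -> (l2sq (A u) <= opnorm A ^+ 2 * l2sq u)%E.
Proof.
move=> AZ ufin; have l2sqZ (K : choiceType) (r : R) (v : K -> 'cV[R[i]]_n) :
    l2sq (fun x => r%:C%C *: v x) = ((r ^+ 2)%:E * l2sq v)%E.
  rewrite -esumZl ?sqr_ge0//; last by move=> x _; rewrite lee_fin sqn_ge0.
  by apply: eq_esum => x _; rewrite sqnZ EFinM.
have: (0 <= l2sq u)%E by exact: l2sq_ge0.
rewrite le_eqVlt => /predU1P[u0|u0].
  have u0' : u = (fun x => 0%:C%C *: u x).
    apply/funext => x; rewrite scale0r; apply: sqn_eq0; apply/eqP.
    by rewrite eq_le sqn_ge0 andbT -lee_fin (le_trans (sqn_le_l2sq u x))// -u0.
  by rewrite u0' AZ l2sqZ expr0n mul0e mule_ge0 ?l2sq_ge0 ?sqre_ge0.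
have /fineK uE : l2sq u \is a fin_num by rewrite ge0_fin_numE ?ltW.
move: u0; rewrite -uE lte_fin => N0; set N := fine _ in uE N0 *.
set r := (Num.sqrt N)^-1.
have rN : r ^+ 2 = N^-1 by rewrite exprVn sqr_sqrtr// ltW.
have h : (l2norm (A (fun x => r%:C%C *: u x)) <= opnorm A)%E.
  apply: ereal_sup_ubound; exists (fun x => r%:C%C *: u x) => //=.
  by rewrite l2normE l2sqZ -uE rN -EFinM mulVf ?gt_eqF//= sqrtr1.
have h2 : (l2sq (A (fun x => r%:C%C *: u x)) <= opnorm A ^+ 2)%E.
  by rewrite -[leLHS]sqr_sqrte ?l2sq_ge0// lee_sqr ?sqrte_ge0 ?opnorm_ge0.
move: h2; rewrite AZ l2sqZ rN => h2.
have -> : l2sq (A u) = (N%:E * (N^-1%:E * l2sq (A u)))%E.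
  by rewrite muleA -EFinM divff ?gt_eqF// mul1e.
by rewrite muleC lee_wpmul2r// lee_fin ltW.
Qed.

(** * Splitting by the length of the uncancelled prefix *)

Lemma scaler_fsumr (K : fieldType) (V : lmodType K) (I : choiceType) (r : K)
  (P : set I) (F : I -> V) :
  r *: (\sum_(i \in P) F i) = \sum_(i \in P) r *: F i.
Proof.
have [->|r0] := eqVneq r 0.
  by rewrite scale0r fsbig1// => i _; rewrite scale0r.
rewrite scaler_sumr.
have -> // : finite_support 0 P F = finite_support 0 P (fun i => r *: F i).
rewrite /finite_support !unlock.
suff -> : (fun i => r *: F i) @^-1` [set~ 0] = F @^-1` [set~ 0] by [].
by apply/seteqP; split=> i /eqP Fi; apply/eqP; move: Fi;
  rewrite scaler_eq0 (negbTE r0).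
Qed.

Section PrefixOperator.
Variables (R : realType) (d n : nat) (a : d.-tuple nat -> 'M[R[i]]_n).
Local Notation word := (seq (nat * bool)).
Implicit Types (V : word -> 'cV[R[i]]_n) (y : word).

(** The part of the convolution operator in which exactly the letters
   [k_(l+1), ..., k_d] of [k] are cancelled: the operator sends the word
   [k_(d)^-1 ... k_(l+1)^-1 w] to the words [k_1 ... k_l w] with matrix
   coefficients [a k]. It acts on functions on all words, reduced or not. *)
Definition prefix_op (l : nat) V y : 'cV[R[i]]_n :=
  \sum_(k \in [set: d.-tuple nat])
    if pos_word (take l k) == take l y
    then a k *m V (neg_word (drop l k) ++ drop l y) else 0.

(** For a fixed tail [w], [prefix_op l] is the block matrix [M_l]. *)
Lemma prefix_op_pos (l : 'I_d.+1) V (s : l.-tuple nat) w :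
  prefix_op l V (pos_word s ++ w) =
  block_op (block_matrix a l) (fun t => V (neg_word t ++ w)) s.
Proof.
have sz : size (pos_word s) = l by rewrite size_map size_tuple.
have cE (t : (d - l).-tuple nat) : cat_index s t = s ++ t :> seq nat.
  by rewrite /cat_index val_tcast.
have ci : injective (@cat_index d l s).
  move=> t t' /(congr1 val) /=; rewrite !cE => /eqP.
  by rewrite eqseq_cat// eqxx => /eqP /val_inj.
rewrite /prefix_op /block_op /block_matrix.
transitivity (\sum_(t \in [set: (d - l).-tuple nat])
    (fun k : d.-tuple nat => a k *m V (neg_word (drop l k) ++ w))
      (cat_index s t)); last first.
  by apply: eq_fsbigr => t _; rewrite /= cE drop_size_cat ?size_tuple.
rewrite -(@fsbig_image _ _ _ _ _ _ (@cat_index d l s)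
  (fun k : d.-tuple nat => a k *m V (neg_word (drop l k) ++ w)));
  last exact: (in2W ci).
rewrite [RHS]fsbig_mkcond; apply: eq_fsbigr => k _.
rewrite take_size_cat// drop_size_cat// (inj_eq pos_word_inj) /patch.
case: ifPn => [/eqP e|e]; last first.
  case: ifPn => //; rewrite inE => -[t _ tk]; move: e.
  by rewrite -tk cE take_size_cat ?eqxx// size_tuple.
rewrite mem_set//.
have sd : size (drop l k) == (d - l)%N by rewrite size_drop size_tuple.
exists (Tuple sd) => //; apply: val_inj; rewrite [LHS]cE /=.
by rewrite -[s : seq _]e cat_take_drop.
Qed.

Lemma prefix_op_neq0 (l : 'I_d.+1) V y : prefix_op l V y != 0 ->
  exists (s : l.-tuple nat) w, y = pos_word s ++ w.
Proof.
apply: contra_neqP => no; apply: fsbig1 => k _; case: ifP => // /eqP e.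
have sl : size (take l k) == l.
  by rewrite size_takel// size_tuple -ltnS.
by case: no; exists (Tuple sl), (drop l y); rewrite /= e cat_take_drop.
Qed.

Lemma block_opZ (l : 'I_d.+1) (r : R) v :
  block_op (block_matrix a l) (fun t => r%:C%C *: v t) =
  (fun s => r%:C%C *: block_op (block_matrix a l) v s).
Proof.
apply/funext => s; rewrite /block_op scaler_fsumr.
by apply: eq_fsbigr => t _; rewrite scalemxAr.
Qed.

(** [prefix_op l] is a direct sum, indexed by the tails [w], of copies of the
   block matrix [M_l]: both (prefix, tail) decompositions of words are injective because
   the length of the prefix is fixed. *)
Lemma l2sq_prefix_op (l : 'I_d.+1) (c : R) V :
  (opnorm (block_op (block_matrix a l)) ^+ 2 = c%:E)%E ->
  (l2sq V < +oo)%E -> (l2sq (prefix_op l V) <= c%:E * l2sq V)%E.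
Proof.
move=> cE Vfin.
have c0 : 0 <= c by rewrite -lee_fin -cE sqre_ge0.
pose e (z : word * l.-tuple nat) := pos_word z.2 ++ z.1.
pose e' (z : word * (d - l).-tuple nat) := neg_word z.2 ++ z.1.
have ie : injective e.
  move=> [w s] [w' s'] /eqP; rewrite /e /= eqseq_cat; last first.
    by rewrite !size_map !size_tuple.
  by move=> /andP[/eqP/pos_word_inj/val_inj -> /eqP ->].
have ie' : injective e'.
  move=> [w s] [w' s'] /eqP; rewrite /e' /= eqseq_cat; last first.
    by rewrite !size_neg_word !size_tuple.
  by move=> /andP[/eqP/neg_word_inj/val_inj -> /eqP ->].
rewrite {1}/l2sq (esum_inj_eq ie); last first.
  move=> y; have [->|] := eqVneq (prefix_op l V y) 0.
    by rewrite sqn0 eqxx.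
  by move=> /prefix_op_neq0[s [w ->]] _; exists (w, s).
rewrite -(esum_pair
  (f := fun w s => (sqn (prefix_op l V (e (w, s))))%:E)); last first.
  by move=> *; rewrite lee_fin sqn_ge0.
have Vw w : (l2sq (fun t : (d - l).-tuple nat => V (neg_word t ++ w)) < +oo)%E.
  apply: le_lt_trans Vfin.
  apply: (@esum_inj_le _ _ _ (fun t : (d - l).-tuple nat => neg_word t ++ w)
    (fun y => (sqn (V y))%:E)); last by move=> y; rewrite lee_fin sqn_ge0.
  move=> t t' /eqP; rewrite eqseq_cat ?size_neg_word ?size_tuple//.
  by move=> /andP[/eqP/neg_word_inj/val_inj].
apply: (@le_trans _ _ (\esum_(w in [set: word])
    (c%:E * l2sq (fun t : (d - l).-tuple nat => V (neg_word t ++ w))))%E).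
  apply: le_esum => w _.
  have := l2sq_le_opnorm (@block_opZ l) (Vw w); rewrite cE; apply: le_trans.
  by apply: le_esum => s _; rewrite /e prefix_op_pos.
rewrite esumZl//; last by move=> w _; exact: l2sq_ge0.
rewrite lee_wpmul2l ?lee_fin//.
rewrite (esum_pair (f := fun w t => (sqn (V (e' (w, t))))%:E)); last first.
  by move=> *; rewrite lee_fin sqn_ge0.
apply: le_trans (esum_inj_le ie' _); last by move=> y; rewrite lee_fin sqn_ge0.
by apply: le_esum => -[].
Qed.

(** The restriction of [V] to the words whose initial run of inverse letters
   has length exactly [m]. *)
Definition restrict_neg (m : nat) V y : 'cV[R[i]]_n :=
  if find (predC snd) y == m then V y else 0.

(** If the initial positive run of [y] is longer than [l], the remainder
   [drop l y] begins with a positive letter, so that [neg_word] of a tail of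
   length [d - l] is the whole initial inverse run of the argument of [V]. *)
Lemma prefix_op_restrict (l : 'I_d.+1) V y : find snd y != l ->
  prefix_op l V y = prefix_op l (restrict_neg (d - l) V) y.
Proof.
move=> yl; apply: eq_fsbigr => k _; case: ifP => // /eqP e; congr (_ *m _).
rewrite /restrict_neg find_neg_word_cat size_drop size_tuple.
suff -> : find (predC snd) (drop l y) = 0%N by rewrite addn0 eqxx.
move: yl; rewrite -{1}(cat_take_drop l y) -e find_pos_word_cat.
rewrite size_takel ?size_tuple -1?ltnS//.
case: (drop l y) => [|[j b] w] /=; first by rewrite addn0 eqxx.
by case: b => //=; rewrite addn0 eqxx.
Qed.

(** The restrictions to distinct run lengths have disjoint supports. *)
Lemma sum_restrict_neg V y :
  \sum_(l < d.+1) sqn (restrict_neg (d - l) V y) <= sqn (V y).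
Proof.
set m := find (predC snd) y.
have E (l : 'I_d.+1) : sqn (restrict_neg (d - l) V y) =
    if m == (d - l)%N then sqn (V y) else 0.
  by rewrite /restrict_neg -/m; case: ifP => //; rewrite sqn0.
rewrite (eq_bigr _ (fun l _ => E l)).
case: (pickP (fun l : 'I_d.+1 => m == (d - l)%N)) => [l0 ml0|no]; last first.
  by rewrite big1 ?sqn_ge0// => l _; rewrite no.
rewrite (bigD1 l0)//= ml0 big1 ?addr0// => l ll0; case: eqP => // ml.
case/eqP: ll0; apply: val_inj => /=.
by rewrite -[LHS](subKn (leq_ord l)) -ml (eqP ml0) subKn ?leq_ord.
Qed.

Hypothesis ha : finite_set [set k : d.-tuple nat | a k != 0].

Lemma sum_tensor_opE (v : free_group nat -> 'cV[R[i]]_n) (y : free_group nat) :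
  (\sum_(k \in [set: d.-tuple nat])
     tensor_op (a k) (left_regular (gen_word k))) v y =
  \sum_(l < d.+1) prefix_op l (extend0 v) (fg_word y).
Proof.
have Kout (k : d.-tuple nat) : k \notin fset_set [set k | a k != 0] -> a k = 0.
  by rewrite in_fset_set// notin_setE/= => /negP; rewrite negbK => /eqP.
rewrite (@fsbigTE _ _ _ _ (fset_set [set k | a k != 0])); last first.
  move=> k /Kout ->; apply/funext => u; apply/funext => x.
  by rewrite /tensor_op mul0mx.
have prefixE (l : 'I_d.+1) : prefix_op l (extend0 v) (fg_word y) =
    \sum_(k <- fset_set [set k | a k != 0])
      if pos_word (take l k) == take l (fg_word y)
      then a k *m extend0 v (neg_word (drop l k) ++ drop l (fg_word y)) else 0.
  rewrite /prefix_op (@fsbigTE _ _ _ _ (fset_set [set k | a k != 0]))//.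
  by move=> k /Kout ->; rewrite mul0mx if_same.
rewrite [RHS](eq_bigr _ (fun l _ => prefixE l)).
rewrite exchange_big !fct_sumE /=; apply: eq_bigr => k _.
have -> : tensor_op (a k) (left_regular (gen_word k)) v y =
    a k *m extend0 v (rmul (neg_word k) (fg_word y)).
  rewrite /tensor_op; congr (_ *m _); apply/colP => i.
  have -> : rmul (neg_word k) (fg_word y) = fg_word ((gen_word k)^-1 * y)%g.
    by rewrite /neg_word -gen_wordE.
  by rewrite mxE extend0E.
rewrite extend0_rmul_neg ?fg_reduced// size_tuple mulmx_sumr.
by apply: eq_bigr => l _; case: ifP => // _; rewrite mulmx0.
Qed.

End PrefixOperator.

(** * The norm estimate *)

Section NormEstimate.
Variables (R : realType) (d n : nat) (a : d.-tuple nat -> 'M[R[i]]_n).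
Local Notation word := (seq (nat * bool)).

(** The pointwise estimate. The term whose length [l] is that of the whole
   initial positive run of [y] is kept apart; the remaining ones are replaced
   by means of [prefix_op_restrict] and handled by Cauchy-Schwarz. *)
Lemma sqn_sum_prefix_op_le (c : 'I_d.+1 -> R) (V : word -> 'cV[R[i]]_n)
    (y : word) :
  (forall l, 0 <= c l) ->
  (forall l, c l = 0 -> prefix_op a l (restrict_neg (d - l) V) y = 0) ->
  sqn (\sum_(l < d.+1) prefix_op a l V y) <=
  \sum_(l < d.+1) (2 * sqn (prefix_op a l V y) +
    2 * (\sum_l c l) / c l * sqn (prefix_op a l (restrict_neg (d - l) V) y)).
Proof.
move=> c0 cP; set m := find snd y.
(* [main] has at most one nonzero term for each [y]. *)
pose main (l : 'I_d.+1) := if l == m :> nat then prefix_op a l V y else 0.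
pose bdry (l : 'I_d.+1) := if l == m :> nat then 0
  else prefix_op a l (restrict_neg (d - l) V) y.
have -> : \sum_(l < d.+1) prefix_op a l V y = \sum_l main l + \sum_l bdry l.
  rewrite -big_split; apply: eq_bigr => l _; rewrite /main /bdry /=.
  case: eqVneq => [_|lm]; first by rewrite addr0.
  by rewrite add0r -prefix_op_restrict// eq_sym.
rewrite big_split /= -mulr_sumr; apply: le_trans (sqnD_le _ _) _.
apply: lerD; rewrite ?ler_pM2l//.
  case: (pickP (fun l : 'I_d.+1 => l == m :> nat)) => [l0 /eqP l0m|no].
    rewrite (bigD1 l0)//= big1 ?addr0 => [|l ll0]; last first.
      rewrite /main; case: eqP => // lm; case/eqP: ll0; apply: val_inj.
      by rewrite /= l0m.
    have -> : main l0 = prefix_op a l0 V y by rewrite /main l0m eqxx.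
    rewrite (bigD1 l0)//= lerDl sumr_ge0// => l _.
    exact: sqn_ge0.
  rewrite big1 => [|l _]; last by rewrite /main no.
  by rewrite sqn0 sumr_ge0// => l _; exact: sqn_ge0.
apply: (@le_trans _ _ (2 * ((\sum_l c l) * \sum_l sqn (bdry l) / c l))).
  rewrite ler_pM2l// sqn_sum_le// => l cl0.
  by rewrite /bdry cP// if_same.
rewrite mulrA mulr_sumr; apply: ler_sum => l _.
rewrite -!mulrA !ler_wpM2l ?sumr_ge0// mulrC ler_wpM2l ?invr_ge0//.
by rewrite /bdry; case: ifP => // _; rewrite sqn0 sqn_ge0.
Qed.

Hypothesis ha : finite_set [set k : d.-tuple nat | a k != 0].

(** The inequality with constant 2, in squared form. *)
Lemma l2sq_sum_tensor_op_le (c : 'I_d.+1 -> R)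
    (v : free_group nat -> 'cV[R[i]]_n) :
  (forall l, opnorm (block_op (block_matrix a l)) ^+ 2 = (c l)%:E)%E ->
  (l2sq v < +oo)%E ->
  (l2sq ((\sum_(k \in [set: d.-tuple nat])
     tensor_op (a k) (left_regular (gen_word k)))%R v)
   <= (4 * \sum_l c l)%:E * l2sq v)%E.
Proof.
move=> cE vfin.
have c0 l : 0 <= c l by rewrite -lee_fin -cE sqre_ge0.
have S0 : 0 <= \sum_l c l by rewrite sumr_ge0.
set V := extend0 v.
have VE : l2sq V = l2sq v.
  rewrite /l2sq (esum_inj_eq (e := @fg_word nat)); first last.
  - move=> w; case: (boolP (reduced w)) => [rw _|nrw].
      by exists (FreeGroup rw).
    by rewrite /V extend0_out// sqn0 eqxx.
  - exact: val_inj.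
  by apply: eq_esum => x _; rewrite /V extend0E.
have Vm m : (l2sq (restrict_neg m V) <= l2sq V)%E.
  apply: le_esum => w _; rewrite lee_fin /restrict_neg.
  by case: ifP => // _; rewrite sqn0 sqn_ge0.
have Vfin : (l2sq V < +oo)%E by rewrite VE.
have Vmfin m : (l2sq (restrict_neg m V) < +oo)%E := le_lt_trans (Vm m) Vfin.
have cP l w : c l = 0 -> prefix_op a l (restrict_neg (d - l) V) w = 0.
  move=> cl0; apply: sqn_eq0; apply/eqP; rewrite eq_le sqn_ge0 andbT -lee_fin.
  apply: le_trans (sqn_le_l2sq _ _) _.
  by apply: le_trans (l2sq_prefix_op (cE l) (Vmfin _)) _; rewrite cl0 mul0e.
pose bound (w : word) := (\sum_(l < d.+1) (2 * sqn (prefix_op a l V w) +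
    2 * (\sum_l c l) / c l *
      sqn (prefix_op a l (restrict_neg (d - l) V) w)))%:E.
have t0 l : 0 <= 2 * (\sum_l c l) / c l by rewrite divr_ge0// mulr_ge0.
have bound0 w : (0 <= bound w)%E.
  rewrite lee_fin sumr_ge0// => l _.
  by rewrite addr_ge0// mulr_ge0// sqn_ge0.
apply: (@le_trans _ _ (\esum_(w in [set: word]) bound w)%E).
  apply: le_trans (esum_inj_le (e := @fg_word nat) val_inj bound0).
  apply: le_esum => y _; rewrite (sum_tensor_opE ha) lee_fin.
  by apply: sqn_sum_prefix_op_le => // l; exact: cP.
rewrite /bound; under eq_esum do rewrite -sumEFin.
rewrite esum_sum; last first.
  by move=> w l _ _; rewrite lee_fin addr_ge0// mulr_ge0// sqn_ge0.
apply: (@le_trans _ _ (\sum_(l < d.+1) ((2 * c l)%:E * l2sq V +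
    (2 * \sum_l c l)%:E * l2sq (restrict_neg (d - l) V)))%E).
  apply: lee_sum => l _; under eq_esum => w _ do
    rewrite EFinD (EFinM 2) (EFinM (2 * (\sum_l c l) / c l)).
  rewrite esumD; last 2 first.
  - by move=> w _; rewrite mule_ge0// lee_fin sqn_ge0.
  - by move=> w _; rewrite mule_ge0// lee_fin ?sqn_ge0// mulr_ge0.
  rewrite !esumZl//; last 2 first.
  - by move=> w _; rewrite lee_fin sqn_ge0.
  - by move=> w _; rewrite lee_fin sqn_ge0.
  apply: leeD.
    rewrite EFinM -muleA lee_wpmul2l ?lee_fin//.
    exact: l2sq_prefix_op.
  apply: le_trans (lee_wpmul2l _ (l2sq_prefix_op (cE l) (Vmfin _))) _.
    by rewrite lee_fin.
  rewrite muleA -EFinM lee_wpmul2r ?l2sq_ge0// lee_fin.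
  have [->|cl0] := eqVneq (c l) 0; first by rewrite mulr0 mulr_ge0.
  by rewrite divfK.
rewrite big_split /= -ge0_sume_distrl; last first.
  by move=> l _; rewrite lee_fin mulr_ge0.
rewrite -ge0_sume_distrr; last by move=> l _; exact: l2sq_ge0.
rewrite sumEFin -mulr_sumr -VE.
have -> : (4 * \sum_l c l) = 2 * (\sum_l c l) + 2 * (\sum_l c l) by ring.
rewrite EFinD ge0_muleDl ?lee_fin ?mulr_ge0//.
rewrite leeD2l// lee_wpmul2l ?lee_fin ?mulr_ge0//.
rewrite /l2sq -esum_sum; last by move=> w l _ _; rewrite lee_fin sqn_ge0.
by apply: le_esum => w _; rewrite sumEFin lee_fin sum_restrict_neg.
Qed.

End NormEstimate.

Theorem theorem0p3 (R : realType) (d n : nat) (hd : (1 <= d)%N)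
    (a : d.-tuple nat -> 'M[R[i]]_n)
    (ha : finite_set [set k : d.-tuple nat | a k != 0]) :
  (opnorm (\sum_(k \in [set: d.-tuple nat])
             tensor_op (a k) (left_regular (gen_word k)))%R
   <= (4 ^+ 5 * Num.sqrt (expR 1))%:E
      * sqrte (\sum_(l < d.+1) opnorm (block_op (block_matrix a l)) ^+ 2))%E.
Proof.
pose N (l : 'I_d.+1) := opnorm (block_op (block_matrix a l)).
have K2 : 2 <= 4 ^+ 5 * Num.sqrt (expR 1) :> R.
  have e1 : 1 <= Num.sqrt (expR 1) :> R.
    by rewrite -[leLHS]sqrtr1 ler_sqrt ?expR_gt0// -expR0 ler_expR.
  by move: (Num.sqrt _) e1 => s e1; rewrite -natrX; lra.
have K0 : 0 < 4 ^+ 5 * Num.sqrt (expR 1) :> R by apply: lt_le_trans K2.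
have [fin|] := boolP [forall l, N l ^+ 2 \is a fin_num]%E; last first.
  (* an infinite norm on the right makes the inequality trivial *)
  rewrite negb_forall => /existsP[l Nl].
  have Nl_oo : (opnorm (block_op (block_matrix a l)) ^+ 2 = +oo)%E.
    by apply/eqP; move: Nl; rewrite ge0_fin_numE ?sqre_ge0// ltey negbK.
  rewrite [X in sqrte X](_ : _ = +oo%E).
    by rewrite /= gt0_muley ?lte_fin// leey.
  rewrite (bigD1 l)// Nl_oo; apply: addye; rewrite gt_eqF//.
  by rewrite (lt_le_trans ltNy0)// sume_ge0// => j _; exact: sqre_ge0.
pose c l := fine (N l ^+ 2)%E.
have cE l : (opnorm (block_op (block_matrix a l)) ^+ 2 = (c l)%:E)%E.
  by rewrite -/(N l) fineK//; move/forallP: fin.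
have c0 l : 0 <= c l by rewrite -lee_fin -cE sqre_ge0.
rewrite (eq_bigr _ (fun l _ => cE l)).
rewrite sumEFin /=; apply: ge_ereal_sup => _ [v /= v1] <-.
have v1' : (l2sq v <= 1)%E.
  have one2 : (1 ^+ 2 = 1 :> \bar R)%E by rewrite expe2 mule1.
  by rewrite -[leLHS]sqr_sqrte ?l2sq_ge0// -one2 lee_sqr ?sqrte_ge0.
have vfin : (l2sq v < +oo)%E by apply: le_lt_trans v1' _; exact: ltry.
have h : (l2sq ((\sum_(k \in [set: d.-tuple nat])
    tensor_op (a k) (left_regular (gen_word k)))%R v) <= (4 * \sum_l c l)%:E)%E.
  apply: le_trans (l2sq_sum_tensor_op_le ha cE vfin) _.
  by rewrite -[leRHS]mule1 lee_wpmul2l// lee_fin mulr_ge0// sumr_ge0.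
rewrite l2normE; apply: (@le_trans _ _ (sqrte (4 * \sum_l c l)%:E)).
  by rewrite lee_sqrt// lee_fin mulr_ge0// sumr_ge0.
have sqrt4 : Num.sqrt 4 = 2 :> R.
  by rewrite (_ : 4 = 2 ^+ 2) ?sqrtr_sqr ?ger0_norm//; ring.
by rewrite /= lee_fin sqrtrM// sqrt4 ler_wpM2r.
Qed.
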